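(* Let $\mathbb K$ be a field of characteristic zero, let $A$ be a commutative associative $\mathbb K$-algebra with identity which is an integral domain, let $R$ be the quotient field of $A$, and let $W(A)=R\,\mathrm{Der}\,A$. Let $L$ be a solvable $\mathbb K$-subalgebra of rank $k$ over $R$ of the Lie algebra $W(A)$. Then the derived length $s(L)$ of $L$ does not exceed $2k$. Moreover, if $L$ is finite dimensional over its field of constants $F=F(L)$ (i.e. $\dim_F FL<\infty$), then $s(L)\le k+1$.
   Context: $\mathrm{Der}\,A$ denotes the Lie algebra of all $\mathbb K$-derivations of $A$; it is an $A$-module via $(aD)(x)=a\cdot D(x)$. Every derivation of $A$ extends uniquely to a derivation of the quotient field $R$, so $W(A)=R\,\mathrm{Der}\,A$ (the set of all $R$-linear combinations of such extended derivations) is a $\mathbb K$-Lie subalgebra of $\mathrm{Der}\,R$ and a vector space over $R$ (it is not in general a Lie algebra over $R$). Subalgebras of $W(A)$ are $\mathbb K$-subalgebras. For a subalgebra $L\subseteq W(A)$: $RL$ is the $R$-span of $L$ and the rank of $L$ over $R$ is $\mathrm{rk}_R L=\dim_R RL$; the field of constants of $L$ is $F(L)=\{r\in R \mid D(r)=0 \text{ for all } D\in L\}$, a subfield of $R$; $FL$ is the $F$-span of $L$ in $W(A)$, which is a Lie algebra over $F=F(L)$. $s(L)$ denotes the derived length of a solvable Lie algebra $L$. *)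

(* Defs.v *)
From HB Require Import structures.
From mathcomp Require Import all_boot all_order all_algebra.
From mathcomp Require Import boolp classical_sets.

Set Implicit Arguments.
Unset Strict Implicit.
Unset Printing Implicit Defensive.

Import GRing.Theory.
Local Open Scope ring_scope.
Local Open Scope classical_set_scope.

(* Commutative associative unital K-algebras that are integral domains. *)
#[short(type="idomainAlgType")]
HB.structure Definition IdomainAlgebra (K : nzRingType) :=
  {A of GRing.IntegralDomain A & GRing.ComUnitAlgebra K A}.

(* [iota : K -> B] is the structure map of a K-algebra B.                     *)
Definition derivation (K : Type) (B : comNzRingType) (iota : K -> B)
    (D : B -> B) : Prop :=
  [/\ forall x y, D (x + y) = D x + D y,
      forall c x, D (iota c * x) = iota c * D x
    & forall x y, D (x * y) = D x * y + x * D y].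

Section OperatorsOnField.

Variable R : fieldType.
Implicit Types (F : set R) (S L V : set (R -> R)).

(* Operators on R are plain functions, with pointwise operations; R acts by   *)
(* (r D)(x) = r D(x). The scalars of a vector space of operators range over a *)
(* subfield F of R, given as a subset of R.                                   *)

Definition lincomb n (c : 'I_n -> R) (D : 'I_n -> R -> R) : R -> R :=
  fun x => \sum_(i < n) c i * D i x.

Definition lspan F S : set (R -> R) :=
  [set E | exists n (c : 'I_n -> R) (D : 'I_n -> R -> R),
     [/\ forall i, F (c i), forall i, S (D i) & E = lincomb c D]].

Definition lfree F n (D : 'I_n -> R -> R) : Prop :=
  forall c : 'I_n -> R, (forall i, F (c i)) ->
    lincomb c D = (fun=> 0) -> forall i, c i = 0.

(* dim_F V = n, for an F-subspace V. *)
Definition has_dim F V (n : nat) : Prop :=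
  exists2 b : 'I_n -> R -> R, lfree F b & lspan F (range b) = V.

Definition bracket (D E : R -> R) : R -> R := fun x => D (E x) - E (D x).

Definition constants L : set R := [set r | forall D, L D -> D r = 0].

Definition has_rank L (k : nat) : Prop := has_dim setT (lspan setT L) k.

Definition fin_dim_over_constants L : Prop :=
  exists n, has_dim (constants L) (lspan (constants L) L) n.

(* In the rest of the section F is the image in R of the ground field, so     *)
(* that an F-span is a linear span over the ground field.                     *)

Definition derived_algebra F L : set (R -> R) :=
  lspan F [set E | exists D1 D2, [/\ L D1, L D2 & E = bracket D1 D2]].

Definition derived_series F L (n : nat) : set (R -> R) :=
  iter n (derived_algebra F) L.

Definition lie_solvable F L : Prop :=
  exists n, derived_series F L n = [set fun=> 0].

Lemma lie_solvable_asbool F L : lie_solvable F L ->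
  exists n, `[< derived_series F L n = [set fun=> 0] >].
Proof. by case=> n Ln0; exists n; apply/asboolP. Qed.

Definition derived_length F L (solL : lie_solvable F L) : nat :=
  ex_minn (lie_solvable_asbool solL).

End OperatorsOnField.

Section DerivationsOfDomain.

Variables (K : fieldType) (A : idomainAlgType K).

Local Notation R := {fraction A}.

Definition ground (c : K) : R := tofrac (c%:A : A).

Definition ground_field : set R := range ground.

Definition DerA : set (A -> A) := [set d | derivation (in_alg A) d].

Definition extended_derivations : set (R -> R) :=
  [set D | derivation ground D /\
     exists2 d, DerA d & forall a : A, D (tofrac a) = tofrac (d a)].

(* W(A) = R Der A *)
Definition WA : set (R -> R) := lspan setT extended_derivations.

Definition lie_subalgebra (L : set (R -> R)) : Prop :=
  [/\ L `<=` WA,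
      L (fun=> 0),
      forall D E, L D -> L E -> L (fun x => D x + E x),
      forall c D, L D -> L (fun x => ground c * D x)
    & forall D E, L D -> L E -> L (bracket D E)].

End DerivationsOfDomain.

Arguments ground_field {K} A.
Arguments WA {K} A.

(* Main.v *)
Require Import Defs.
From HB Require Import structures.
From mathcomp Require Import all_boot all_order all_algebra.
From mathcomp Require Import boolp classical_sets functions.
From mathcomp Require Import ring.

(** Write L_i for the derived series of L and M for the R-span R L. Both bounds
    are proved by climbing down from M to 0 through R-subspaces S of M that are
    stable under L and under the bracket: if d is the codimension of S in M,
    then S contains L_(2d), and even L_(d+1) when L is finite dimensional over
    its constants ([derived_series_rank], [derived_series_fin_dim]). The rank
    is the codimension of S = 0.

    Suppose that S does not contain L. Some L_m is not contained in S while
    L_(m+1) is. Over a suitable field C of constants, the C-span of L_m modulo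
    S is finite dimensional; the elements of L act on it by semilinear
    operators (they may move the scalars), and it is abelian modulo S. Let I be
    a minimal nonzero L-stable C-subspace of it. Then S' = R I has smaller
    codimension than S, so the induction hypothesis applies to S'. To come
    down from S' to S, two facts are used.

    - Let E and E' be elements of L that kill C, hence act C-linearly on I / S.
      Then their actions on I / S commute ([irreducible_layer]). This is a form
      of Lie's theorem for a solvable family normalised by an irreducible
      family of semilinear operators, proved through traces rather than
      eigenvectors: if [b,c] commutes with c, all the powers of [b,c] have trace
      zero, so [b,c] is nilpotent in characteristic zero; a commuting family of
      such nilpotents has a nonzero common kernel, which is stable, hence
      everything by irreducibility ([irreducible_commutators]).
    - If E, E' in R I centralise I modulo S, then [E,E'] is in S: modulo S they
      are combinations of elements of I whose coefficients are killed by I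
      ([abelian_layer]).

    For the bound 2d, C is the field of constants of L_m and S together, so
    that all of R I kills C. Since L_(2d-2) lies in S', it acts C-linearly;
    L_(2d-1) then centralises I modulo S, and L_(2d) lies in S. For the bound
    d + 1, C is the field of constants of L. Now all of L acts C-linearly, and
    its derived algebra centralises I modulo S; as L_d lies in S' and, for
    d > 0, in the derived algebra of L, the next term L_(d+1) lies in S. *)

Set Implicit Arguments.
Unset Strict Implicit.
Unset Printing Implicit Defensive.

Import GRing.Theory.
Local Open Scope ring_scope.
Local Open Scope classical_set_scope.

(** * Nilpotent matrices and traces *)

(** A rank factorisation e = P Q of an idempotent satisfies Q P = 1, so that
    tr e = tr (Q P) counts the rank. *)
Lemma idempotent_trace (C : fieldType) n (e : 'M[C]_n) :
  e *m e = e -> \tr e = (\rank e)%:R.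
Proof.
move=> ee; have QP1 : row_base e *m col_base e = 1%:M.
  have Pfree : row_full (col_base e) by exact: col_base_full.
  have Qfree : row_free (row_base e) by exact: row_base_free.
  apply: (row_full_inj Pfree); apply: (row_free_inj Qfree).
  by rewrite mulmx1 mulmxA mulmx_base -mulmxA mulmx_base ee.
by rewrite -{1}[e]mulmx_base mxtrace_mulC QP1 mxtrace1.
Qed.

(** The characteristic polynomial is X^m q with q(0) <> 0. A Bezout relation
    between X^(m+1) and q gives a polynomial in M without constant term which
    is the projection onto the part where M is invertible. Its trace is zero by
    assumption, so its rank is zero in characteristic zero. *)
Lemma nilpotent_of_traces (C : fieldType) n (M : 'M[C]_n) :
  [pchar C]%R =i pred0 -> (forall m, \tr (M ^+ m.+1) = 0) ->
  exists m, M ^+ m = 0.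
Proof.
case: n M => [|n] M charC trM; first by exists 0; apply/matrixP; case.
have [m [q /implyP q0 Dp]] := multiplicity_XsubC (char_poly M) 0.
rewrite monic_neq0 ?char_poly_monic // in q0; move: q0 => /(_ isT) q0.
rewrite subr0 in Dp.
have /Bezout_coprimepP [[u v] /=] : coprimep ('X^(m.+1)) q.
  by rewrite coprimep_expl // coprimep_sym -['X]subr0 coprimep_XsubC.
rewrite -size_poly_eq1 => /size_poly1P [c nzc Dc].
pose P := c^-1 *: u * 'X^(m.+1); pose Q := c^-1 *: v * q.
have PQ1 : P + Q = 1.
  by rewrite /P /Q -!scalerAl -scalerDr Dc -mul_polyC -polyCM mulVf.
pose e := horner_mx M P; pose f := horner_mx M Q.
have ef1 : e + f = 1 by rewrite -rmorphD PQ1 rmorph1.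
have Mf : M ^+ m *m f = 0.
  rewrite -{1}(horner_mx_X M) -rmorphXn -[_ *m _]rmorphM /Q mulrCA.
  rewrite ['X^m * q]mulrC -Dp.
  by rewrite rmorphM /= Cayley_Hamilton mulr0.
have ef0 : e *m f = 0.
  rewrite /e /P exprS mulrA rmorphM /= rmorphXn /= horner_mx_X.
  by rewrite -[LHS]mulrA [X in _ * X]Mf mulr0.
have ee : e *m e = e.
  by rewrite -[RHS]mulmx1 -[1%:M]/(1 : 'M_n.+1) -ef1 mulmxDr ef0 addr0.
have trX r : forall j, \tr (M ^+ j.+1 * horner_mx M r) = 0.
  elim/poly_ind: r => [|r a IHr] j; first by rewrite rmorph0 mulr0 mxtrace0.
  rewrite rmorphD [r * 'X]mulrC rmorphM /= horner_mx_X horner_mx_C.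
  rewrite mulrDr mxtraceD.
  rewrite mulrA -exprSr IHr add0r.
  by rewrite -[_ * _]/(_ *m _) mul_mx_scalar mxtraceZ trM mulr0.
have tre : \tr e = 0.
  rewrite /e /P exprSr mulrA mulrC rmorphM /= horner_mx_X.
  by rewrite -[M in M * _]expr1 trX.
have e0 : e = 0.
  apply/eqP; rewrite -mxrank_eq0; move/pcharf0P: charC => <-.
  by rewrite -idempotent_trace ?tre.
exists m; rewrite -[LHS]mulr1 -ef1 e0 add0r; exact: Mf.
Qed.

(** Among the nonzero matrices commuting with X, take B of least rank. For N in
    X the product B N has the same row space as B or vanishes; the former would
    give B = Y^m B N^m for all m, against the nilpotency of N. Hence B N = 0 and
    any nonzero row combination of B will do. *)
Lemma commuting_nilpotents_common_kernel (C : fieldType) n (X : set 'M[C]_n) :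
    (0 < n)%N ->
    (forall M N, X M -> X N -> M *m N = N *m M) ->
    (forall M, X M -> exists m, M ^+ m = 0) ->
  exists2 v : 'rV_n, v != 0 & forall M, X M -> v *m M = 0.
Proof.
move=> n_gt0 commX nilX.
pose Q r := exists B : 'M[C]_n,
  [/\ B != 0, \rank B = r & forall N, X N -> B *m N = N *m B].
have exQ : exists r, `[< Q r >].
  exists n; apply/asboolP; exists 1%:M; split; rewrite ?mxrank1 //.
    by rewrite -mxrank_eq0 mxrank1 -lt0n.
  by move=> N _; rewrite mul1mx mulmx1.
case: (ex_minnP exQ) => r /asboolP [B [nzB rB commB]] minr.
have BX0 N : X N -> B *m N = 0.
  move=> XN; apply/eqP; apply/negPn/negP => nzBN.
  have rBN : (\rank B <= \rank (B *m N))%N.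
    rewrite rB; apply: minr; apply/asboolP; exists (B *m N); split=> // N' XN'.
    by rewrite mulmxA -commB // -!mulmxA (commX _ _ XN' XN).
  have sBN : (B *m N <= B)%MS by rewrite commB // submxMl.
  have /submxP [Y DY] : (B <= B *m N)%MS.
    by rewrite -(mxrank_leqif_sup sBN) eqn_leq rBN mxrankS.
  have BYN m : B = Y ^+ m *m B *m N ^+ m.
    elim: m => [|m IHm]; first by rewrite !expr0 mul1mx mulmx1.
    rewrite {1}IHm {1}DY exprSr exprS -[_ * Y]/(_ *m Y) -[N * _]/(N *m _).
    by rewrite !mulmxA.
  have [m Nm0] := nilX _ XN.
  by move: nzB; rewrite (BYN m) Nm0 mulmx0 eqxx.
have /rowV0Pn [v /submxP [u Du] nzv] : B != 0 by [].
exists v => // M XM; by rewrite Du -mulmxA BX0 ?mulmx0.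
Qed.

(** * Irreducible actions of solvable families of operators *)

Section IrreducibleActions.

Variables (C : fieldType) (n : nat).
Hypothesis charC : [pchar C]%R =i pred0.

(** Matrices act on row vectors from the right. The members of g are arbitrary
    maps rather than matrices because elements of L act semilinearly, not
    linearly, over the field of constants in use. *)
Definition irreducible (g : set ('rV[C]_n -> 'rV[C]_n)) : Prop :=
  forall X : set 'rV[C]_n,
    (forall v w, X v -> X w -> X (v + w)) ->
    (forall c v, X v -> X (c *: v)) ->
    (forall s v, g s -> X v -> X (s v)) ->
    (exists2 v, X v & v != 0) -> forall v, X v.

(** The bracket of s with the operator B is linear even when s is only
    semilinear; it is required to be the operator of a member of b. *)
Definition normalises (g : set ('rV[C]_n -> 'rV[C]_n)) (b : set 'M[C]_n) :=
  forall s B, g s -> b B ->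
    exists2 B', b B' & forall v, s (v *m B) - s v *m B = v *m B'.

Definition commutator (A B : 'M[C]_n) := A *m B - B *m A.

Lemma commutator0P (A B : 'M[C]_n) : commutator A B = 0 <-> A *m B = B *m A.
Proof. by rewrite /commutator; split=> [/subr0_eq|->] //; rewrite subrr. Qed.

Lemma commutator_derivation (A B D : 'M[C]_n) :
  commutator (commutator A B) D =
  commutator (commutator A D) B + commutator A (commutator B D).
Proof.
rewrite /commutator !(mulmxBl, mulmxBr) !mulmxA !opprB !addrA.
rewrite [RHS](ACl ((1*6)*(3*8)*5*4*7*2)%AC) /=.
by rewrite !subrr !add0r.
Qed.

(** A = [B,D] commutes with D, so A^(m+1) = [B A^m, D] is a commutator. *)
Lemma commutator_traces (B D : 'M[C]_n) :
  commutator (commutator B D) D = 0 ->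
  forall m, \tr (commutator B D ^+ m.+1) = 0.
Proof.
move=> /commutator0P cBD m; set A := commutator B D in cBD *.
have cAm : A ^+ m *m D = D *m A ^+ m.
  by apply: commr_sym; apply: commrX; apply: esym.
rewrite exprS -[_ * _]/(_ *m _) {1}/A mulmxBl -mulmxA -cAm raddfB /=.
by rewrite mulmxA mxtrace_mulC mulmxA subrr.
Qed.

Variable g : set ('rV[C]_n -> 'rV[C]_n).
Hypothesis irr_g : irreducible g.

(** By hypothesis each [B,D] commutes with D, so it is nilpotent; the Jacobi
    identity makes all these commutators commute with each other. Their common
    kernel is nonzero, and it is stable under g because g normalises b and c;
    irreducibility makes it the whole space. *)
Lemma irreducible_commutators (b c : set 'M[C]_n) :
    normalises g b -> normalises g c ->
    (forall B, b B -> g (fun v => v *m B)) ->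
    (forall B D D', b B -> c D -> c D' -> commutator (commutator B D) D' = 0) ->
  forall B D, b B -> c D -> commutator B D = 0.
Proof.
move=> gb gc bg bcc0.
case: (posnP n) => [n0 B D _ _|n_gt0].
  by apply/matrixP=> i; have := ltn_ord i; rewrite [X in (_ < X)%N]n0.
(* b consists of operators in g, so it normalises itself and c. *)
have adb (a : set 'M[C]_n) B' A : normalises g a -> b B' -> a A ->
    a (commutator A B').
  move=> ga bB' aA; have [A' aA' DA'] := ga _ A (bg _ bB') aA.
  suff -> : commutator A B' = A' by [].
  apply/row_matrixP=> i; rewrite !rowE /commutator mulmxBr !mulmxA.
  exact: DA'.
pose X := [set A | exists B D, [/\ b B, c D & A = commutator B D]].
have commX M N : X M -> X N -> M *m N = N *m M.
  move=> [B1 [D1 [bB1 cD1 DM]]] [B2 [D2 [bB2 cD2 DN]]].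
  apply/commutator0P; have MD2 : M *m D2 = D2 *m M.
    by apply/commutator0P; rewrite DM bcc0.
  have : commutator (commutator M B2) D2 = 0.
    have commD A B D : commutator (A + B) D = commutator A D + commutator B D.
      by rewrite /commutator mulmxDl mulmxDr opprD addrACA.
    rewrite DM (commutator_derivation B1 D1 B2) commD.
    rewrite (bcc0 _ _ _ (adb _ _ _ gb bB2 bB1) cD1 cD2).
    by rewrite (bcc0 _ _ _ bB1 (adb _ _ _ gc bB2 cD1) cD2) addr0.
  rewrite commutator_derivation [commutator M D2]/commutator MD2 subrr.
  by rewrite {1}/commutator mul0mx mulmx0 subrr add0r DN.
have nilX M : X M -> exists m, M ^+ m = 0.
  move=> [B [D [bB cD ->]]]; apply: nilpotent_of_traces => //.
  by apply: commutator_traces; apply: bcc0.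
have [v nzv vX] := commuting_nilpotents_common_kernel n_gt0 commX nilX.
pose W := [set v : 'rV[C]_n | forall M, X M -> v *m M = 0].
have WT : forall v, W v.
  apply: irr_g; last by exists v.
  - by move=> x y Wx Wy M XM; rewrite mulmxDl Wx // Wy // addr0.
  - by move=> a x Wx M XM; rewrite -scalemxAl Wx // scaler0.
  move=> s x gs Wx _ [B [D [bB cD ->]]].
  have [B' bB' sB] := gb _ _ gs bB; have [D' cD' sD] := gc _ _ gs cD.
  have X_comm E F : X (commutator E F) -> x *m E *m F = x *m F *m E.
    by move=> /Wx; rewrite /commutator mulmxBr !mulmxA => /subr0_eq.
  have sBx y : s y *m B = s (y *m B) - y *m B' by rewrite -sB opprB addrC subrK.
  have sDx y : s y *m D = s (y *m D) - y *m D' by rewrite -sD opprB addrC subrK.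
  rewrite /commutator mulmxBr !mulmxA sBx sDx !mulmxBl sDx sBx.
  rewrite (X_comm B D) ?(X_comm B D') ?(X_comm B' D).
  - by rewrite [X in X - _]addrAC subrr.
  - by exists B', D.
  - by exists B, D'.
  - by exists B, D.
move=> B D bB cD; apply/row_matrixP=> i; rewrite !rowE mulmx0.
by apply: WT; exists B, D.
Qed.

(** Descending induction on the index from which on the family is abelian. If
    h (m+1) is abelian, then [h m, h (m+1)] lies in h (m+1) and commutes with
    it, so it vanishes by the previous lemma; now [h m, h m] commutes with
    h m, so it vanishes by the same lemma. *)
Lemma irreducible_solvable_abelian (h : nat -> set 'M[C]_n) (m : nat) :
    (forall i B, h i B -> g (fun v => v *m B)) ->
    (forall i, normalises g (h i)) ->
    (forall i B, h i.+1 B -> h i B) ->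
    (forall i B D, h i B -> h i D -> h i.+1 (commutator B D)) ->
    (forall B, h m B -> B = 0) ->
  forall B D, h 0%N B -> h 0%N D -> commutator B D = 0.
Proof.
move=> hg gh h_decr h_comm hm0; have {m hm0} [m] : exists m, forall B D,
    h m B -> h m D -> commutator B D = 0.
  by exists m => B D hB hD; rewrite (hm0 B) // (hm0 D) // /commutator subrr.
elim: m => [//|m IHm] hm; apply: IHm.
have hmm B D : h m B -> h m.+1 D -> commutator B D = 0.
  apply: (irreducible_commutators (gh m) (gh m.+1) (hg m)) => E F F' hE hF.
  by apply: hm; apply: h_comm => //; apply: h_decr.
apply: (irreducible_commutators (gh m) (gh m) (hg m)) => E F F' hE hF hF'.
(* The previous step is applied with the arguments in the other order. *)
have -> A A' : commutator A A' = - commutator A' A by rewrite /commutator opprB.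
by rewrite hmm ?oppr0 //; apply: h_comm.
Qed.

End IrreducibleActions.

(** * Subfields as field types, and spans modulo a subspace *)

Section SubfieldType.

Variables (R : fieldType) (P : set R).
Hypotheses (P1 : P 1) (PB : forall x y, P x -> P y -> P (x - y)).
Hypotheses (PM : forall x y, P x -> P y -> P (x * y)).
Hypothesis (PV : forall x, P x -> P x^-1).

Definition in_subfield : {pred R} := fun x => `[< P x >].

Lemma in_subfieldP x : reflect (P x) (x \in in_subfield).
Proof. exact: asboolP. Qed.

Lemma in_subfield_divring_closed : divring_closed in_subfield.
Proof.
split; first exact/in_subfieldP.
  by move=> x y /in_subfieldP Px /in_subfieldP Py; apply/in_subfieldP/PB.
by move=> x y /in_subfieldP Px /in_subfieldP Py; apply/in_subfieldP/PM/PV.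
Qed.

HB.instance Definition _ :=
  GRing.isDivringClosed.Build R in_subfield in_subfield_divring_closed.

Record subfield_type := SubfieldElt {
  subfield_val : R; _ : subfield_val \in in_subfield }.

HB.instance Definition _ := [isSub for subfield_val].
HB.instance Definition _ := [Choice of subfield_type by <:].
HB.instance Definition _ :=
  [SubChoice_isSubIntegralDomain of subfield_type by <:].
HB.instance Definition _ :=
  [SubIntegralDomain_isSubField of subfield_type by <:].

(** Fields of constants arise as sets; linear algebra over them needs a field
    type together with its embedding into R. *)
Lemma subfield_embedding : exists (C : fieldType) (iota : {rmorphism C -> R}),
  forall x, P x <-> exists c, iota c = x.
Proof.
exists subfield_type, (val : {rmorphism subfield_type -> R}) => x.
split=> [Px | [c <-]]; last exact/in_subfieldP/valP.
have Qx : x \in in_subfield by apply/in_subfieldP.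
by exists (SubfieldElt Qx).
Qed.

End SubfieldType.

Section RelativeSpans.

Variables (R C : fieldType) (V : lmodType R) (iota : {rmorphism C -> R}).
Implicit Types (S I : set V).

(** Scalars act through iota, so that the same V can be studied over R and over
    its various subfields. *)
Definition combo n (D : 'I_n -> V) (v : 'rV[C]_n) : V :=
  \sum_(i < n) iota (v 0 i) *: D i.

Lemma comboD n (D : 'I_n -> V) v w : combo D (v + w) = combo D v + combo D w.
Proof.
by rewrite -big_split; apply: eq_bigr => i _; rewrite mxE rmorphD scalerDl.
Qed.

Lemma comboZ n (D : 'I_n -> V) c v : combo D (c *: v) = iota c *: combo D v.
Proof.
by rewrite scaler_sumr; apply: eq_bigr => i _; rewrite mxE rmorphM scalerA.
Qed.

Lemma combo0 n (D : 'I_n -> V) : combo D 0 = 0.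
Proof. by apply: big1 => i _; rewrite mxE rmorph0 scale0r. Qed.

Lemma comboB n (D : 'I_n -> V) v w : combo D (v - w) = combo D v - combo D w.
Proof. by rewrite comboD -[- w]scaleN1r comboZ rmorphN1 scaleN1r. Qed.

Lemma combo_sub n (D E : 'I_n -> V) v :
  combo (fun i => D i - E i) v = combo D v - combo E v.
Proof. by rewrite -sumrB; apply: eq_bigr => i _; rewrite scalerBr. Qed.

Lemma combo_delta n (D : 'I_n -> V) i : combo D (delta_mx 0 i) = D i.
Proof.
rewrite /combo (bigD1 i) //= big1 => [|j /negPf ji].
  by rewrite mxE !eqxx rmorph1 scale1r addr0.
by rewrite mxE ji rmorph0 scale0r.
Qed.

Lemma combo_lift n (D : 'I_n.+1 -> V) i v :
  combo D v = iota (v 0 i) *: D i + combo (D \o lift i) (col' i v).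
Proof.
rewrite /combo (bigD1_ord i) //=; congr (_ + _).
by apply: eq_bigr => j _; rewrite mxE.
Qed.

Lemma combo_mul m n (D : 'I_n -> V) (B : 'M[C]_(m, n)) u :
  combo D (u *m B) = combo (fun i => combo D (row i B)) u.
Proof.
rewrite mulmx_sum_row (big_morph _ (comboD D) (combo0 D)).
by apply: eq_bigr => i _; rewrite comboZ.
Qed.

Definition subspace S : Prop :=
  [/\ S 0, forall x y, S x -> S y -> S (x + y)
    & forall c x, S x -> S (iota c *: x)].

Lemma zero_subspace : subspace [set 0].
Proof.
by split=> // [_ _ -> ->|c _ ->]; rewrite /= ?addr0 ?scaler0.
Qed.

Lemma subspaceB S x y : subspace S -> S x -> S y -> S (x - y).
Proof.
move=> [_ SD SZ] Sx Sy; apply: SD => //; rewrite -scaleN1r.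
by rewrite -(rmorphN1 iota); apply: SZ.
Qed.

Lemma subspace_combo S n (D : 'I_n -> V) v :
  subspace S -> (forall i, S (D i)) -> S (combo D v).
Proof. by move=> [S0 SD SZ] SDi; apply: big_ind => // i _; apply: SZ. Qed.

(** The subspace spanned by D and S; all linear algebra below takes place modulo
    S without forming the quotient V / S. *)
Definition cspan n (D : 'I_n -> V) S : set V :=
  [set x | exists v, S (x - combo D v)].

Definition free_mod n (D : 'I_n -> V) S : Prop :=
  forall v, S (combo D v) -> v = 0.

Section Span.

Variable S : set V.
Hypothesis subS : subspace S.

Lemma cspan_base n (D : 'I_n -> V) : S `<=` cspan D S.
Proof. by move=> x Sx; exists 0; rewrite combo0 subr0. Qed.

Lemma cspan_combo n (D : 'I_n -> V) v : cspan D S (combo D v).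
Proof. by exists v; rewrite subrr; case: subS. Qed.

Lemma cspan_gen n (D : 'I_n -> V) i : cspan D S (D i).
Proof. by rewrite -(combo_delta D i); apply: cspan_combo. Qed.

Lemma cspan_subspace n (D : 'I_n -> V) : subspace (cspan D S).
Proof.
case: (subS) => S0 SD SZ; split; first exact: cspan_base.
- move=> x y [v Sv] [w Sw]; exists (v + w).
  by rewrite comboD opprD addrACA; apply: SD.
- move=> c x [v Sv]; exists (c *: v).
  by rewrite comboZ -scalerBr; apply: SZ.
Qed.

Lemma cspan_min n (D : 'I_n -> V) T :
  subspace T -> S `<=` T -> (forall i, T (D i)) -> cspan D S `<=` T.
Proof.
move=> subT ST TD x [v /ST Sv]; rewrite -(subrK (combo D v) x).
by case: (subT) => _ TA _; apply: TA => //; apply: subspace_combo.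
Qed.

End Span.

(** Exchange: a relation modulo a larger S' with a nonzero coefficient at i
    makes the generator D i redundant. *)
Lemma cspan_drop n (D : 'I_n -> V) S S' v :
    subspace S' -> S `<=` S' -> v != 0 -> S' (combo D v) ->
  exists n' (D' : 'I_n' -> V),
    [/\ n = n'.+1, forall i, range D (D' i) & cspan D S `<=` cspan D' S'].
Proof.
move=> subS' SS' /rV0Pn [i nzvi]; case: n D v i nzvi => [|n] D v i nzvi S'v.
  by case: i nzvi.
exists n, (D \o lift i); split=> [//|j|]; first by exists (lift i j).
have subT := cspan_subspace subS' (D \o lift i).
apply: cspan_min => // [x /SS'|j]; first exact: cspan_base.
case: (unliftP i j) => [j' -> | ->]; first exact: (cspan_gen subS').
have -> : D i = iota (v 0 i)^-1 *: (combo D v - combo (D \o lift i) (col' i v)).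
  by rewrite (combo_lift _ i) addrK scalerA -rmorphM mulVf // rmorph1 scale1r.
case: (subT) => _ _ TZ; apply: TZ; apply: (subspaceB subT).
  exact: cspan_base.
exact: cspan_combo.
Qed.

(** Enlarging S by an element of the span lowers the number of generators; this
    is how codimensions are counted. *)
Lemma cspan_quotient n (D : 'I_n -> V) S S' x :
    subspace S' -> S `<=` S' -> cspan D S x -> S' x -> ~ S x ->
  exists n' (D' : 'I_n' -> V), n = n'.+1 /\ cspan D S `<=` cspan D' S'.
Proof.
move=> subS' SS' [v Sv] S'x nSx.
have nzv : v != 0.
  by apply/eqP => v0; move: Sv; rewrite v0 combo0 subr0.
have S'v : S' (combo D v).
  by rewrite -[combo D v](subKr x); apply: subspaceB => //; apply: SS'.
by have [n' [D' [Dn _ sDD']]] := cspan_drop subS' SS' nzv S'v; exists n', D'.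
Qed.

(** Induction on the number of generators: an element of I outside S goes into
    the basis, and is then added to S. *)
Lemma relative_basis n (b : 'I_n -> V) S I :
    subspace S -> I `<=` cspan b S ->
  exists m (D : 'I_m -> V),
    [/\ forall i, I (D i), free_mod D S & I `<=` cspan D S].
Proof.
elim: n S b => [|n IHn] S b subS sIb.
  have D : 'I_0 -> V by case.
  exists 0%N, D; split=> [[]//|v _|x /sIb [v]]; first by rewrite thinmx0.
  by rewrite /combo big_ord0 => Sx; exists v; rewrite /combo big_ord0.
case: (pselect (I `<=` S)) => [sIS | /existsNP [x /not_implyP [Ix nSx]]].
  have D : 'I_0 -> V by case.
  exists 0%N, D; split=> [[]//|v _|x Ix]; first by rewrite thinmx0.
  exact/cspan_base/sIS.
pose S' := cspan (fun _ : 'I_1 => x) S.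
have subS' : subspace S' by apply: cspan_subspace.
have SS' : S `<=` S' by apply: cspan_base.
have S'x : S' x by exact: (cspan_gen subS (fun=> x) ord0).
have [n' [b' [[En] sbb']]] := cspan_quotient subS' SS' (sIb _ Ix) S'x nSx.
subst n'.
have [m [D [ID freeD sID]]] := IHn S' b' subS' (subset_trans sIb sbb').
pose D1 (i : 'I_m.+1) := if unlift ord0 i is Some j then D j else x.
have D1lift : D1 \o lift ord0 = D by apply/funext=> j; rewrite /D1 /= liftK.
have D10 : D1 ord0 = x by rewrite /D1 unlift_none.
exists m.+1, D1; split=> [i|v|y /sID [u [w]]].
- by rewrite /D1; case: unlift.
- rewrite (combo_lift _ ord0) D1lift D10 => Sv.
  have v'0 : col' ord0 v = 0.
    apply: freeD; rewrite -[combo _ _](addKr (iota (v 0 ord0) *: x)).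
    case: (subS') => _ S'D S'Z; apply: S'D; last exact: SS'.
    by rewrite -scaleNr -rmorphN; apply: S'Z.
  apply/rowP=> j; rewrite mxE; case: (unliftP ord0 j) => [k ->|->].
    by have /rowP/(_ k) := v'0; rewrite !mxE.
  apply: contra_notP nSx => /eqP nz; move: Sv; rewrite v'0 combo0 addr0 => Sv.
  case: (subS) => _ _ SZ; have := SZ (v 0 ord0)^-1 _ Sv.
  by rewrite scalerA -rmorphM mulVf // rmorph1 scale1r.
rewrite /combo big_ord1 -/(combo _ _) => Sy.
exists (\row_i if unlift ord0 i is Some j then u 0 j else w 0 0).
rewrite (combo_lift _ ord0) D1lift D10 mxE unlift_none.
have -> : col' ord0 (\row_i if unlift ord0 i is Some j then u 0 j else w 0 0)
  = u by apply/rowP=> j; rewrite !mxE liftK.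
by rewrite [_ *: _ + _]addrC opprD addrA.
Qed.

(** A matrix of maximal rank among those with row space inside X. *)
Lemma row_subspace_matrix n (X : set 'rV[C]_n) :
    X 0 -> (forall v w, X v -> X w -> X (v + w)) ->
    (forall c v, X v -> X (c *: v)) ->
  exists B : 'M[C]_n, forall v, X v <-> (v <= B)%MS.
Proof.
move=> X0 XD XZ.
pose Q r := exists2 B : 'M[C]_n, \rank B = r & forall v, (v <= B)%MS -> X v.
have exQ : exists r, `[< Q r >].
  exists 0%N; apply/asboolP; exists 0; rewrite ?mxrank0 // => v.
  by move/submxP=> [u ->]; rewrite mulmx0.
have leQ r : `[< Q r >] -> (r <= n)%N.
  by move=> /asboolP [B <- _]; apply: rank_leq_row.
case: (ex_maxnP exQ leQ) => r /asboolP [B rB BX] maxr.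
exists B => v; split=> [Xv|]; last exact: BX.
have BvX w : (w <= B + v)%MS -> X w.
  move=> /sub_addsmxP [[a c] /= ->]; apply: XD.
    by apply: BX; apply: submxMl.
  by rewrite [c]mx11_scalar mul_scalar_mx; apply: XZ.
have rBv : (\rank (B + v)%MS <= \rank B)%N.
  by rewrite rB; apply: maxr; apply/asboolP; exists (B + v)%MS.
have : (B + v <= B)%MS.
  by rewrite -(mxrank_leqif_sup (addsmxSl B v)) eqn_leq rBv mxrankS ?addsmxSl.
by apply: submx_trans; apply: addsmxSr.
Qed.

(** D is a family with the least number of elements whose span is stable and
    not contained in S. Minimality gives freeness, since a relation would drop a
    generator, and irreducibility, since a stable proper subspace of coordinate
    vectors has a basis with fewer elements. *)
Lemma minimal_stable_span S (T : set (V -> V)) n0 (D0 : 'I_n0 -> V) :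
    subspace S ->
    (forall t x y, T t -> t (x + y) = t x + t y) ->
    (forall t x, T t -> S x -> S (t x)) ->
    (forall t x, T t -> cspan D0 S x -> cspan D0 S (t x)) ->
    ~ cspan D0 S `<=` S ->
  exists n (D : 'I_n -> V),
  [/\ cspan D S `<=` cspan D0 S,
      forall t x, T t -> cspan D S x -> cspan D S (t x),
      ~ cspan D S `<=` S, free_mod D S
    & forall X : set 'rV[C]_n, 
        (forall v w, X v -> X w -> X (v + w)) ->
        (forall c v, X v -> X (c *: v)) ->
        (forall t v w, T t -> X v -> S (t (combo D v) - combo D w) -> X w) ->
        (exists2 v, X v & v != 0) -> forall v, X v].
Proof.
move=> subS addT stabS stabD0 nD0S.
pose Q n := exists D : 'I_n -> V, [/\ cspan D S `<=` cspan D0 S,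
  forall t x, T t -> cspan D S x -> cspan D S (t x) & ~ cspan D S `<=` S].
have exQ : exists n, `[< Q n >] by exists n0; apply/asboolP; exists D0; split.
case: (ex_minnP exQ) => n /asboolP [D [DD0 stabD nDS]] minn.
exists n, D.
have subD := cspan_subspace subS D.
have minD n' (D' : 'I_n' -> V) :
    cspan D' S `<=` cspan D S ->
    (forall t x, T t -> cspan D' S x -> cspan D' S (t x)) ->
    ~ cspan D' S `<=` S -> (n <= n')%N.
  move=> sD'D stabD' nD'S; apply: minn; apply/asboolP; exists D'; split=> //.
  exact: subset_trans DD0.
have freeD : free_mod D S.
  move=> v Sv; apply/eqP/negPn/negP => nzv.
  have [n' [D' [Dn D'D sDD']]] := cspan_drop subS (fun _ => id) nzv Sv.
  have sD'D : cspan D' S `<=` cspan D S.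
    apply: cspan_min => [//||i]; first exact: cspan_base.
    by have [j _ <-] := D'D i; apply: cspan_gen.
  have eDD' : cspan D' S = cspan D S by apply/seteqP.
  have := minD _ D'; rewrite eDD' => /(_ (fun _ => id) stabD nDS).
  by rewrite Dn ltnn.
split=> // X XD XZ Xstab [v Xv nzv].
have X0 : X 0 by rewrite -(scale0r v); apply: XZ.
have [B XB] := row_subspace_matrix X0 XD XZ.
pose D' i := combo D (row i (row_base B)).
have XD' x : cspan D' S x <-> exists2 v, X v & S (x - combo D v).
  split=> [[u Su] | [w /XB]].
    exists (u *m row_base B); last by rewrite combo_mul.
    by apply/XB; rewrite -(eq_row_base B) submxMl.
  rewrite -(eq_row_base B) => /submxP [u ->] Su.
  by exists u; rewrite -combo_mul.
have rB : (n <= \rank B)%N.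
  apply: (minD _ D').
  - by move=> x /XD' [w _ Sw]; exists w.
  - move=> t x Tt /XD' [w Xw Sw].
    have [u Su] := stabD _ _ Tt (cspan_combo subS D w).
    apply/XD'; exists u; first exact: Xstab Tt Xw Su.
    case: (subS) => _ SD _; rewrite -{1}(subrK (combo D w) x) addT // -addrA.
    by apply: SD => //; apply: stabS.
  - move=> sD'S; case/eqP: nzv; apply: freeD; apply: sD'S; apply/XD'.
    by exists v => //; rewrite subrr; case: subS.
move=> w; apply/XB; apply: submx_full.
by rewrite /row_full eqn_leq rank_leq_col rB.
Qed.

End RelativeSpans.

(** * Derivations of a field and their brackets *)

Section Operators.

Variable R : fieldType.
Local Notation op := (R -> R^o).
Local Notation rid := (idfun : {rmorphism R -> R}).
Implicit Types (D E G T : op) (S I X Y : set op).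

Definition additive_op D := forall x y, D (x + y) = D x + D y.

Definition is_derivation D :=
  additive_op D /\ forall x y, D (x * y) = D x * y + x * D y.

Lemma additive_op0 D : additive_op D -> D 0 = 0.
Proof. by move=> DD; apply: (addrI (D 0)); rewrite -DD !addr0. Qed.

Lemma additive_opB D x y : additive_op D -> D (x - y) = D x - D y.
Proof. by move=> DD; apply: (addIr (D y)); rewrite -DD !subrK. Qed.

Lemma bracketC D E : bracket D E = - bracket E D :> op.
Proof. by apply/funext=> x; rewrite /bracket !fctE; ring. Qed.

Lemma bracket0r G : additive_op G -> bracket G (0 : op) = 0 :> op.
Proof.
move=> GA; apply/funext=> x.
by rewrite /bracket -[X in G X]/(0 : R) -[0 (G x)]/(0 : R) additive_op0 ?subrr.
Qed.

Lemma bracket0l G : additive_op G -> bracket (0 : op) G = 0 :> op.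
Proof. by move=> GA; rewrite bracketC bracket0r // oppr0. Qed.

Lemma bracketDr D E T : additive_op D ->
  bracket D (E + T) = bracket D E + bracket D T :> op.
Proof. by move=> DD; apply/funext=> x; rewrite /bracket !fctE DD; ring. Qed.

Lemma bracketBr D E T : additive_op D ->
  bracket D (E - T) = bracket D E - bracket D T :> op.
Proof.
move=> DD; apply/funext=> x; rewrite /bracket !fctE (additive_opB _ _ DD).
by ring.
Qed.

Lemma bracketZr D E (f : R) : is_derivation D ->
  bracket D (f *: E) = D f *: E + f *: (bracket D E : op) :> op.
Proof.
move=> [DD DM]; apply/funext=> x; rewrite /bracket !fctE /GRing.scale /= DM.
by ring.
Qed.

Lemma bracketJ D E T : additive_op D -> additive_op E -> additive_op T ->
  bracket (bracket D E) T = bracket D (bracket E T) - bracket E (bracket D T)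
  :> op.
Proof.
move=> DD ED TD; apply/funext=> x; rewrite /bracket !fctE.
rewrite !(additive_opB _ _ DD, additive_opB _ _ ED, additive_opB _ _ TD).
by ring.
Qed.

Lemma bracket_derivation D E :
  is_derivation D -> is_derivation E -> is_derivation (bracket D E).
Proof.
move=> [DD DM] [ED EM]; split=> x y; rewrite /bracket.
  by rewrite ED DD DD ED; ring.
by rewrite EM DM DD ED !DM !EM; ring.
Qed.

Lemma derivation1 D : is_derivation D -> D 1 = 0.
Proof.
move=> [_ DM]; apply: (addrI (D 1)); rewrite addr0.
by have := DM 1 1; rewrite !mulr1 mul1r.
Qed.

Lemma derivationV D x : is_derivation D -> D x = 0 -> D x^-1 = 0.
Proof.
move=> derD Dx; have [->|nzx] := eqVneq x 0.
  by rewrite invr0; apply: additive_op0; case: derD.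
case: (derD) => _ /(_ x x^-1); rewrite mulfV // derivation1 // Dx mul0r add0r.
by move/esym/eqP; rewrite mulf_eq0 (negPf nzx) => /eqP.
Qed.

Lemma constants_subfield X : X `<=` is_derivation ->
  exists (C : fieldType) (iota : {rmorphism C -> R}),
  forall x, constants X x <-> exists c, iota c = x.
Proof.
move=> derX; apply: subfield_embedding.
- by move=> D /derX /derivation1.
- move=> x y cx cy D XD; case: (derX D XD) => DD _.
  by rewrite (additive_opB _ _ DD) (cx D XD) (cy D XD) subrr.
- move=> x y cx cy D XD; case: (derX D XD) => _ ->.
  by rewrite (cx D XD) (cy D XD) mul0r mulr0 addr0.
- by move=> x cx D XD; apply: derivationV; [exact: derX | exact: cx].
Qed.

Definition Rsubspace S := subspace rid S.

Definition Rspan n (D : 'I_n -> op) S := cspan rid D S.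

Lemma Rsubspace_restrict (C : fieldType) (iota : {rmorphism C -> R}) S :
  Rsubspace S -> subspace iota S.
Proof. by move=> [S0 SD SZ]; split=> // c x; apply: SZ. Qed.

Lemma derivation_subspace : Rsubspace is_derivation.
Proof.
split.
- split=> x y; first by rewrite -[RHS]/(0 + 0 : R) addr0.
  by rewrite -[RHS]/(0 * y + x * 0 : R) mul0r mulr0 addr0.
- move=> D E [DD DM] [ED EM].
  by split=> x y; rewrite !fctE ?DD ?ED ?DM ?EM; ring.
- move=> c D [DD DM].
  by split=> x y; rewrite !fctE ?DD ?DM /GRing.scale /=; ring.
Qed.

Lemma bracket_mem_sym (C : fieldType) (iota : {rmorphism C -> R}) S D E :
  subspace iota S -> S (bracket D E) -> S (bracket E D).
Proof.
move=> subS SDE; rewrite (bracketC E D) -sub0r.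
by case: (subS) => S0 _ _; exact: (subspaceB subS S0 SDE).
Qed.

Lemma bracket_combo (C : fieldType) (iota : {rmorphism C -> R}) n
    (D : 'I_n -> op) E v :
  is_derivation E -> (forall c, E (iota c) = 0) ->
  bracket E (combo iota D v) = combo iota (fun i => bracket E (D i) : op) v
  :> op.
Proof.
move=> derE E0; have [ED _] := derE.
rewrite (big_morph (bracket E : op -> op) (id1 := 0) (op1 := +%R)).
- by apply: eq_bigr => i _; rewrite bracketZr // E0 scale0r add0r.
- by move=> x y; exact: bracketDr.
- exact: bracket0r.
Qed.

(** Leibniz rule [G, c T] = G(c) T + c [G,T]: the hypothesis on G (iota c) takes
    care of the first term, the generators of the second. *)
Lemma bracket_cspan (C : fieldType) (iota : {rmorphism C -> R}) n
    (D : 'I_n -> op) S J G :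
    subspace iota S -> subspace iota J -> is_derivation G ->
    (forall c T, cspan iota D S T -> J (G (iota c) *: T)) ->
    (forall T, S T -> J (bracket G T)) -> (forall i, J (bracket G (D i))) ->
  forall T, cspan iota D S T -> J (bracket G T).
Proof.
move=> subS [J0 JD JZ] derG GJ SJ DJ; have [GA _] := derG.
pose Y := [set T : op | cspan iota D S T /\ J (bracket G T)].
suff DY : cspan iota D S `<=` Y by move=> T /DY [].
have [D0 DD DZ] := cspan_subspace subS D.
apply: cspan_min => [|T ST|i].
- split=> [|T U [DT JT] [DU JU]|c T [DT JT]].
  + by split; rewrite ?bracket0r.
  + by split; [exact: DD | rewrite bracketDr //; exact: JD].
  + split; first exact: DZ.
    by rewrite bracketZr //; apply: JD; [exact: GJ | exact: JZ].
- by split; [exact: cspan_base | exact: SJ].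
- by split; [exact: cspan_gen | exact: DJ].
Qed.

Lemma bracket_Rcombo n (D : 'I_n -> op) G (v : 'rV[R]_n) :
  is_derivation G ->
  bracket G (combo rid D v) =
  combo rid D (map_mx G v) +
  combo rid (fun i => bracket G (D i) : op) v :> op.
Proof.
move=> derG; have [GA _] := derG.
rewrite (big_morph (bracket G : op -> op) (id1 := 0) (op1 := +%R)).
- rewrite -big_split; apply: eq_bigr => i _.
  by rewrite mxE [LHS]bracketZr.
- by move=> x y; exact: bracketDr.
- exact: bracket0r.
Qed.

(** Modulo S only the terms G (v_i) D_i of [G, sum v_i D_i] survive; freeness
    forces them to vanish. *)
Lemma coefficients_constant n (D : 'I_n -> op) S G E v :
    Rsubspace S -> free_mod rid D S ->
    is_derivation G -> (forall T, S T -> S (bracket G T)) ->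
    (forall i, S (bracket G (D i))) -> S (bracket G E) ->
    S (E - combo rid D v) ->
  forall i, G (v 0 i) = 0.
Proof.
move=> subS freeD derG GS GD GE Sv; have [S0 SD SZ] := subS.
suff /freeD /rowP v0 : S (combo rid D (map_mx G v)).
  by move=> i; have := v0 i; rewrite !mxE.
set c := combo _ _ _ in Sv.
have -> : combo rid D (map_mx G v) =
    (bracket G E : op) - bracket G (E - c)
    - combo rid (fun i => bracket G (D i) : op) v.
  case: (derG) => GA _.
  by rewrite (bracketBr E c GA) subKr /c bracket_Rcombo // addrK.
apply: (subspaceB subS); last exact: subspace_combo.
by apply: (subspaceB subS) => //; apply: GS.
Qed.

End Operators.

(** * Derived series of a Lie algebra of derivations *)

Section DerivedSeries.

Variables (R : fieldType) (P : set R).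
Local Notation op := (R -> R^o).
Hypotheses (P1 : P 1) (PM : forall x y, P x -> P y -> P (x * y)).
Implicit Types X Y : set op.

Definition Psubspace X :=
  [/\ X 0, forall D E, X D -> X E -> X (D + E)
    & forall c D, P c -> X D -> X (c *: D)].

Lemma lincombE n (c : 'I_n -> R) (D : 'I_n -> op) :
  lincomb c D = \sum_i c i *: D i :> op.
Proof. by rewrite fct_sumE. Qed.

Lemma lspan_gen X : X `<=` lspan P X.
Proof.
move=> D XD; exists 1%N, (fun=> 1), (fun=> D); split=> //.
by rewrite (lincombE _ (fun=> D)) big_ord1 scale1r.
Qed.

Lemma lspan_min X Y : Psubspace Y -> X `<=` Y -> lspan P X `<=` Y.
Proof.
move=> [Y0 YD YZ] sXY _ [n [c [D [Pc XD ->]]]].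
rewrite (lincombE c D); apply: big_ind => // i _.
by apply: YZ => //; apply: sXY.
Qed.

Lemma lspan_subspace X : Psubspace (lspan P X).
Proof.
split.
- exists 0%N, (fun=> 0), (fun=> 0); split; try by case.
  by rewrite (lincombE _ (fun=> 0)) big_ord0.
- move=> _ _ [n1 [c1 [D1 [Pc1 XD1 ->]]]] [n2 [c2 [D2 [Pc2 XD2 ->]]]].
  pose join T (f1 : 'I_n1 -> T) (f2 : 'I_n2 -> T) (i : 'I_(n1 + n2)) :=
    match fintype.split i with inl j => f1 j | inr j => f2 j end.
  exists (n1 + n2)%N, (join _ c1 c2), (join _ D1 D2).
  split; try by move=> i; rewrite /join; case: fintype.split.
  rewrite (lincombE c1 D1) (lincombE c2 D2) (lincombE _ (join _ D1 D2)).
  rewrite big_split_ord; congr (_ + _); apply: eq_bigr => i _.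
    by rewrite /join (unsplitK (inl i)).
  by rewrite /join (unsplitK (inr i)).
- move=> a _ Pa [n [c [D [Pc XD ->]]]].
  exists n, (fun i => a * c i), D; split=> // [i|]; first exact: PM.
  rewrite (lincombE c D) (lincombE _ D) scaler_sumr.
  by apply: eq_bigr => i _; rewrite scalerA.
Qed.

Variable L : set op.
Hypothesis Lsub : Psubspace L.
Hypothesis Lbr : forall D E, L D -> L E -> L (bracket D E).
Hypothesis Lder : L `<=` @is_derivation R.
Hypothesis LP : forall D c, L D -> P c -> D c = 0.

Local Notation L_ i := (derived_series P L i : set op).

Lemma derived_series_bracket i D E :
  L_ i D -> L_ i E -> L_ i.+1 (bracket D E).
Proof. by move=> LD LE; apply: lspan_gen; exists D, E. Qed.

Lemma derived_series_min i Y :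
    Psubspace Y ->
    (forall D E, L_ i D -> L_ i E -> Y (bracket D E)) ->
  L_ i.+1 `<=` Y.
Proof.
move=> subY brY; apply: lspan_min => // _ [D [E [LD LE ->]]]; exact: brY.
Qed.

(** The three properties support each other in the induction: that L_i is an
    ideal of L rests on the Jacobi identity, and brackets with L preserve spans
    over the ground field because L kills that field. *)
Lemma derived_series_ideal i :
  [/\ Psubspace (L_ i), L_ i `<=` L
    & forall G D, L G -> L_ i D -> L_ i (bracket G D)].
Proof.
elim: i => [|i [subLi sLiL LiJ]]; first by split.
have subLi1 : Psubspace (L_ i.+1) by apply: lspan_subspace.
split=> //.
  apply: derived_series_min => // D E /sLiL LD /sLiL LE; exact: Lbr.
move=> G D LG; have derG := Lder LG; have [GD _] := derG.
pose Y := [set E : op | L_ i.+1 (bracket G E)].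
suff : L_ i.+1 `<=` Y by apply.
have [Y0 YD YZ] := subLi1.
apply: derived_series_min => [|E F LE LF].
  split.
  - by rewrite /Y /= bracket0r.
  - by move=> E F YE YF; rewrite /Y /= bracketDr //; apply: YD.
  - move=> c E Pc YE; rewrite /Y /= bracketZr // LP // scale0r add0r.
    exact: YZ.
have [ED _] := Lder (sLiL _ LE); have [FD _] := Lder (sLiL _ LF).
change (L_ i.+1 (bracket G (bracket E F))).
have -> : bracket G (bracket E F) =
    bracket (bracket G E) F + bracket E (bracket G F) :> op.
  by rewrite (bracketJ GD ED FD) subrK.
by apply: YD; apply: derived_series_bracket => //; apply: LiJ.
Qed.

Lemma derived_series_decr i j : (i <= j)%N -> L_ j `<=` L_ i.
Proof.
move=> /subnK <-; elim: (j - i)%N => [//|k IHk]; apply: subset_trans IHk.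
have [subLi sLiL LiJ] := derived_series_ideal (k + i)%N.
by apply: derived_series_min => // D E /sLiL LD LE; apply: LiJ.
Qed.

End DerivedSeries.

(** * Layers of a solvable Lie algebra of derivations *)

Section Layers.

Variables (R : fieldType) (P : set R).
Local Notation op := (R -> R^o).
Local Notation rid := (idfun : {rmorphism R -> R}).
Hypotheses (P1 : P 1) (PM : forall x y, P x -> P y -> P (x * y)).
Variables (L M : set op).
Hypotheses (Lsub : Psubspace P L).
Hypothesis Lbr : forall D E, L D -> L E -> L (bracket D E).
Hypothesis sLM : L `<=` M.
Hypothesis Mder : M `<=` @is_derivation R.
Hypothesis MP : forall D c, M D -> P c -> D c = 0.
Hypothesis Msub : Rsubspace M.
Hypothesis charR : [pchar R]%R =i pred0.
Variable s : nat.
Local Notation L_ i := (derived_series P L i : set op).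
Hypothesis Ls0 : L_ s `<=` [set 0].

Let Lder : L `<=` @is_derivation R.
Proof. exact: subset_trans Mder. Qed.

Let LP D c : L D -> P c -> D c = 0.
Proof. by move=> /sLM; apply: MP. Qed.

Let Lser := derived_series_ideal P1 PM Lsub Lbr Lder LP.

Section IrreducibleLayer.

Variable S : set op.
Hypotheses (subS : Rsubspace S) (sSM : S `<=` M).
Hypothesis SS : forall T U, S T -> S U -> S (bracket T U).
Hypothesis LS : forall G T, L G -> S T -> S (bracket G T).

Variables (C : fieldType) (iota : {rmorphism C -> R}).

Let subSC : subspace iota S.
Proof. exact: Rsubspace_restrict. Qed.

Let kills (D : op) := forall c, D (iota c) = 0.

Section Representation.

Variables (n : nat) (D : 'I_n -> op).
Hypothesis freeD : free_mod iota D S.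
Local Notation phi := (combo iota D).

(** t gives the action of G on the span of D modulo S, in coordinates. *)
Definition represents (G : op) (t : 'rV[C]_n -> 'rV[C]_n) :=
  forall v, S ((bracket G (phi v) : op) - phi (t v)).

Lemma coordinates_unique x v w : S (x - phi v) -> S (x - phi w) -> v = w.
Proof.
move=> Sv Sw; apply/eqP; rewrite -subr_eq0; apply/eqP/freeD.
rewrite comboB; have -> : phi v - phi w = (x - phi w) - (x - phi v).
  by rewrite opprB [RHS]addrC addrA subrK.
exact: (subspaceB subSC).
Qed.

Lemma represents_bracket G E t u :
    (forall i, is_derivation (D i)) -> L G -> L E ->
    represents G t -> represents E u ->
  forall v, S ((bracket (bracket G E) (phi v) : op) - phi (t (u v) - u (t v))).
Proof.
move=> derD LG LE rG rE v; have [GA _] := Lder LG; have [EA _] := Lder LE.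
have [phiA _] : is_derivation (phi v).
  apply: (subspace_combo _ _ derD).
  exact: Rsubspace_restrict (@derivation_subspace R).
rewrite (bracketJ GA EA phiA) comboB.
have step H K r q : L H -> L K -> represents H r -> represents K q ->
    S ((bracket H (bracket K (phi v)) : op) - phi (r (q v))).
  move=> LH LK rH rK; have [HA _] := Lder LH.
  have -> : (bracket H (bracket K (phi v)) : op) - phi (r (q v)) =
      (bracket H ((bracket K (phi v) : op) - phi (q v)) : op) +
      ((bracket H (phi (q v)) : op) - phi (r (q v))).
    by rewrite (bracketBr (bracket K (phi v)) (phi (q v)) HA) addrA subrK.
  by case: (subS) => _ SD _; exact: (SD _ _ (LS LH (rK v)) (rH (q v))).
rewrite [X in S X](_ : _ =
  ((bracket G (bracket E (phi v)) : op) - phi (t (u v))) -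
  ((bracket E (bracket G (phi v)) : op) - phi (u (t v)))).
  apply: (subspaceB subS); first exact: (step _ _ _ _ LG LE rG rE).
  exact: (step _ _ _ _ LE LG rE rG).
by rewrite !opprD !opprK addrACA.
Qed.

End Representation.

(** Elements of L act semilinearly on the span I0 of D0 modulo S, and I is a
    minimal stable subspace of I0. The elements of L killing C form an ideal of
    L acting by matrices; its intersections with the derived series are the
    families h of [irreducible_solvable_abelian]. *)
Lemma irreducible_layer m n0 (D0 : 'I_n0 -> op) :
    [pchar C]%R =i pred0 ->
    (forall i, L_ m (D0 i)) -> L_ m `<=` cspan iota D0 S ->
    ~ L_ m `<=` S -> L_ m.+1 `<=` S ->
    (forall T, L_ m T \/ S T -> kills T) ->
    (forall G c, L G -> exists c', G (iota c) = iota c') ->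
  exists I : set op,
   [/\ [/\ S `<=` I, ~ I `<=` S & I `<=` M],
       forall G T, L G -> I T -> I (bracket G T),
       forall T T', I T -> I T' -> S (bracket T T'),
       forall T, I T -> kills T
     & forall E E' T, L E -> L E' -> kills E -> kills E' -> I T ->
         S (bracket (bracket E E') T)].
Proof.
move=> charC D0m mD0 nmS m1S killC Lcst.
have [_ smL mJ] := Lser m; have [S0 SD SZ] := subSC.
pose I0 := cspan iota D0 S.
have subI0 : subspace iota I0 := cspan_subspace subSC D0.
have I0M : I0 `<=` M.
  apply: cspan_min => // [|i]; first exact: Rsubspace_restrict.
  exact/sLM/smL.
have I0der : I0 `<=` @is_derivation R := subset_trans I0M Mder.
have sub_kills : subspace iota kills.
  split=> [//|T U kT kU c|c T kT c']; first by rewrite !fctE kT kU addr0.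
  by rewrite !fctE kT scaler0.
have I0kills : I0 `<=` kills.
  by apply: cspan_min => // [T ST|i]; apply: killC; [right|left].
have I0L G T : L G -> I0 T -> I0 (bracket G T).
  move=> LG; apply: bracket_cspan => // [|c U I0U|U SU|i].
  - exact: Lder.
  - by have [c' ->] := Lcst _ c LG; case: subI0 => _ _; apply.
  - by apply: cspan_base; apply: LS.
  - by apply: mD0; apply: mJ.
(* C is killed by L_m and S, and the brackets of L_m and S lie in S. *)
have I0S T U : I0 T -> I0 U -> S (bracket T U).
  have kill_bracket G : is_derivation G -> kills G ->
      (forall W, S W -> S (bracket G W)) -> (forall i, S (bracket G (D0 i))) ->
      forall W, I0 W -> S (bracket G W).
    move=> derG kG SG D0G; apply: bracket_cspan => // c W _.
    by rewrite kG scale0r.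
  have SI0 W W' : S W -> I0 W' -> S (bracket W W').
    move=> SW; apply: kill_bracket => [||W''|i].
    - exact/Mder/sSM.
    - by apply: killC; right.
    - exact: SS.
    - by apply: (bracket_mem_sym subSC); apply: LS => //; apply: smL.
  have DI0 i W : I0 W -> S (bracket (D0 i) W).
    apply: kill_bracket => [||W''|j].
    - exact/Lder/smL.
    - by apply: killC; left.
    - by apply: LS; apply: smL.
    - by apply: m1S; apply: derived_series_bracket.
  move=> I0T I0U; apply: kill_bracket I0U => [||W SW|i].
  - exact: I0der.
  - exact: I0kills.
  - by apply: (bracket_mem_sym subSC); apply: SI0.
  - by apply: (bracket_mem_sym subSC); apply: DI0.
pose ops := [set t : op -> op | exists2 G, L G & t = bracket G].
have [||||n [D []]] := @minimal_stable_span R C _ iota S ops n0 D0 subSC.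
- move=> _ x y [G LG ->]; apply: bracketDr; by case: (Lder LG).
- by move=> _ x [G LG ->]; apply: LS.
- by move=> _ x [G LG ->]; apply: I0L.
- by move=> sI0S; apply: nmS; apply: subset_trans sI0S.
set I := cspan iota D S => sII0 IL' nIS freeD irrD.
have sSI : S `<=` I := @cspan_base _ _ _ iota S n D.
have IL G T : L G -> I T -> I (bracket G T).
  by move=> LG; apply: IL'; exists G.
have subI : subspace iota I := cspan_subspace subSC D.
have ID i : I (D i) := cspan_gen subSC D i.
have derD i : is_derivation (D i) by apply/I0der/sII0.
have Iphi v : I (combo iota D v) := cspan_combo subSC D v.
exists I; split=> //.
- by split=> //; apply: subset_trans I0M.
- by move=> T T' /sII0 IT /sII0 IT'; apply: I0S.
- by move=> T /sII0; apply: I0kills.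
pose g := [set t : 'rV[C]_n -> 'rV[C]_n | exists2 G, L G & represents D G t].
pose h i := [set B : 'M[C]_n |
  exists E, [/\ L_ i E, kills E & represents D E (fun v => v *m B)]].
have exg G : L G -> exists t, represents D G t.
  by move=> LG; have [t rt] := choice (fun v => IL _ _ LG (Iphi v)); exists t.
have irr_g : irreducible g.
  move=> X XD XZ Xg; apply: irrD => // _ v w [G LG ->] Xv Sw.
  have [t rt] := exg G LG.
  rewrite (coordinates_unique freeD Sw (rt v)); apply: Xg => //.
  by exists G.
have exh E : L E -> kills E -> exists B, represents D E (fun v => v *m B).
  move=> LE kE; have [w Sw] := choice (fun i => IL _ _ LE (ID i)).
  exists (\matrix_i w i) => v.
  rewrite combo_mul bracket_combo //; last exact: Lder.
  by rewrite -combo_sub; apply: subspace_combo => // i; rewrite rowK.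
have hg i B : h i B -> g (fun v => v *m B).
  by have [_ siL _] := Lser i; move=> [E [/siL LE _ rE]]; exists E.
(* Since L preserves C, the bracket of G in L with an operator killing C kills C
   again. *)
have norm i : normalises g (h i).
  have [_ siL iJ] := Lser i; move=> t B [G LG rG] [E [iE kE rE]].
  have LE := siL _ iE; have [GA _] := Lder LG.
  have kGE : kills (bracket G E).
    move=> c; rewrite /bracket kE (additive_op0 GA) sub0r.
    by have [c' ->] := Lcst G c LG; rewrite kE oppr0.
  have [B' rB'] := exh _ (Lbr LG LE) kGE.
  exists B'; first by exists (bracket G E); split=> //; apply: iJ.
  move=> v; have := represents_bracket derD LG LE rG rE v.
  move=> Sv; exact: (coordinates_unique freeD Sv (rB' v)).
(* Acting on rows from the right reverses the order of brackets. *)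
have hbr E E' B B' : L E -> L E' -> represents D E (fun v => v *m B) ->
    represents D E' (fun v => v *m B') ->
    represents D (bracket E' E) (fun v => v *m commutator B B').
  move=> LE LE' rE rE' v; have := represents_bracket derD LE' LE rE' rE v.
  by rewrite /commutator mulmxBr !mulmxA.
have h_abelian B B' : h 0%N B -> h 0%N B' -> commutator B B' = 0.
  apply: (irreducible_solvable_abelian charC irr_g hg norm (m := s)).
  - move=> i B1 [E [iE kE rE]]; exists E; split=> //.
    exact: (derived_series_decr P1 PM Lsub Lbr Lder LP (leqnSn i)).
  - move=> i B1 B2 [E1 [iE1 kE1 rE1]] [E2 [iE2 kE2 rE2]].
    have [_ siL _] := Lser i; have [LE1 LE2] := (siL _ iE1, siL _ iE2).
    exists (bracket E2 E1); split; last exact: hbr.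
      exact: (derived_series_bracket P1 iE2 iE1).
    have [[E1A _] [E2A _]] := (Lder LE1, Lder LE2).
    move=> c; rewrite /bracket kE1 kE2.
    by rewrite (additive_op0 E1A) (additive_op0 E2A) subrr.
  - move=> B1 [E [/Ls0 E0 kE rE]]; apply/row_matrixP=> i; rewrite row0 rowE.
    have := rE (delta_mx 0 i); rewrite E0 => rEi.
    apply: (coordinates_unique freeD rEi).
    rewrite combo0 subr0 bracket0l //.
    by case: (I0der _ (sII0 _ (Iphi (delta_mx 0 i)))).
move=> E E' T LE LE' kE kE' [v Sv].
have [B rB] := exh _ LE kE; have [B' rB'] := exh _ LE' kE'.
have := hbr _ _ _ _ LE' LE rB' rB v.
rewrite h_abelian; [|by exists E'|by exists E].
rewrite mulmx0 combo0 subr0 => SEv.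
have EE' := bracket_derivation (Lder LE) (Lder LE').
rewrite -(subrK (combo iota D v) T) bracketDr; last by case: EE'.
by apply: SD => //; apply: LS => //; apply: Lbr.
Qed.

End IrreducibleLayer.

(** Closure under the bracket is a separate condition: an R-subspace of R L
    stable under L alone need not be a Lie algebra, because brackets
    differentiate the coefficients. *)
Definition stable_ideal (S : set op) : Prop :=
  [/\ Rsubspace S, S `<=` M, forall T U, S T -> S U -> S (bracket T U)
    & forall G T, L G -> S T -> S (bracket G T)].

(** S' = R I. Write E' = sum v_j D_j modulo S with D_j in I. Since I centralises
    E' modulo S, it kills the v_j, and so does E in R I. Hence
    [E, E'] = sum v_j [E, D_j] = 0 modulo S. *)
Lemma abelian_layer (S I : set op) d (b : 'I_d -> op) :
    stable_ideal S -> M `<=` Rspan b S -> 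
    S `<=` I -> ~ I `<=` S -> I `<=` M ->
    (forall G T, L G -> I T -> I (bracket G T)) ->
    (forall T U, I T -> I U -> S (bracket T U)) ->
  exists d' (b' : 'I_d' -> op) (S' : set op),
    [/\ d = d'.+1, stable_ideal S', M `<=` Rspan b' S',
        forall c : R, (forall T, I T -> T c = 0) -> (forall T, S' T -> T c = 0)
      & forall E E', S' E -> S' E' ->
          (forall T, I T -> S (bracket E T)) ->
          (forall T, I T -> S (bracket E' T)) -> S (bracket E E')].
Proof.
move=> [subS sSM SS LS] Mb sSI nIS sIM IL II.
have [S0 SD SZ] := subS.
have [n [D [ID freeD sID]]] := relative_basis subS (subset_trans sIM Mb).
pose S' := Rspan D S.
have subS' : Rsubspace S' := cspan_subspace subS D.
have sSS' : S `<=` S' := @cspan_base _ _ _ _ S n D.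
have S'min (Y : set op) :
    Rsubspace Y -> S `<=` Y -> (forall i, Y (D i)) -> S' `<=` Y.
  by move=> subY sSY YD; apply: cspan_min.
have sS'M : S' `<=` M.
  by apply: S'min => [//||i]; [exact: subset_trans sIM | exact: sIM].
have S'der : S' `<=` @is_derivation R := subset_trans sS'M Mder.
have S'bracket (G : op) : is_derivation G ->
    (forall T, S T -> S' (bracket G T)) ->
    (forall i, S' (bracket G (D i))) -> forall T, S' T -> S' (bracket G T).
  move=> derG GS GD; apply: bracket_cspan => // c T S'T.
  by case: subS' => _ _; apply.
have S'S' (T U : op) : S' T -> S' U -> S' (bracket T U).
  have IS' V : I V -> forall T, S' T -> S' (bracket V T).
    move=> IV; apply: S'bracket => [|W SW|i].
    - exact/Mder/sIM.
    - by apply: sSS'; apply: II => //; apply: sSI.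
    - by apply: sSS'; apply: II.
  move=> S'T; apply: S'bracket => [|W SW|i].
  - exact: S'der.
  - by apply: (bracket_mem_sym subS'); apply: IS' => //; apply: sSI.
  - by apply: (bracket_mem_sym subS'); apply: IS'.
have LS' (G T : op) : L G -> S' T -> S' (bracket G T).
  move=> LG; apply: S'bracket => [|W SW|i].
  - exact: Lder.
  - by apply: sSS'; apply: LS.
  - by apply: sID; apply: IL.
have kill_S' (c : R) :
    (forall T, I T -> T c = 0) -> forall T, S' T -> T c = 0.
  move=> Ic; apply: S'min => [|T /sSI|i]; [|exact: Ic|exact/Ic/ID].
  split=> [//|T U Tc Uc|f T Tc]; first by rewrite !fctE Tc Uc addr0.
  by rewrite !fctE Tc scaler0.
have [x Ix nSx] : exists2 x, I x & ~ S x.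
  have /existsNP [x /not_implyP [Ix nSx]] := nIS; by exists x.
have [d' [b' [Dd sbb']]] :=
  cspan_quotient subS' sSS' (Mb _ (sIM _ Ix)) (sID _ Ix) nSx.
exists d', b', S'; split=> //; first exact: subset_trans sbb'.
move=> E E' S'E S'E' EI E'I; case: (S'E') => v Sv.
have derE := S'der _ S'E; have [EA _] := derE.
have Ev i : E (v 0 i) = 0.
  apply: kill_S' S'E => T IT.
  apply: (coefficients_constant subS freeD _ _ _ _ Sv).
  - exact/Mder/sIM.
  - by move=> U SU; apply: II => //; apply: sSI.
  - by move=> j; apply: II.
  - by apply: (bracket_mem_sym subS); apply: E'I.
rewrite -(subrK (combo rid D v) E') bracketDr //.
apply: SD; first exact/EI/sSI.
rewrite bracket_Rcombo // (_ : map_mx (E : R -> R) v = 0) ?combo0 ?add0r.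
  by apply: subspace_combo => // i; apply: EI.
by apply/rowP=> i; rewrite !mxE.
Qed.

Lemma last_term_outside (S : set op) : S 0 -> ~ L `<=` S ->
  exists m, ~ L_ m `<=` S /\ L_ m.+1 `<=` S.
Proof.
move=> S0 nLS; have exm : exists m, `[< L_ m `<=` S >].
  by exists s; apply/asboolP => D /Ls0 ->.
case: (ex_minnP exm) => [[|m]] /asboolP mS min_m; first by [].
by exists m; split=> // /asboolP /min_m; rewrite ltnn.
Qed.

(** In an R-basis of L_m modulo S taken from L_m, the coordinates of elements of
    L_m are killed by L_m and S, because L_m is abelian modulo S. So L_m has
    finite dimension modulo S already over the common constants C of L_m and S.
    As L normalises L_m and S, it preserves C. *)
Lemma layer_constants (S : set op) d (b : 'I_d -> op) m :
    stable_ideal S -> M `<=` Rspan b S -> L_ m.+1 `<=` S ->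
  exists (C : fieldType) (iota : {rmorphism C -> R}) n (D : 'I_n -> op),
  [/\ forall i, L_ m (D i), L_ m `<=` cspan iota D S,
      forall T, L_ m T \/ S T -> forall c, T (iota c) = 0
    & forall G c, L G -> exists c', G (iota c) = iota c'].
Proof.
move=> [subS sSM SS LS] Mb m1S; have [_ smL mJ] := Lser m.
have smM : L_ m `<=` M := subset_trans smL sLM.
pose X := [set T : op | L_ m T \/ S T].
have Xder : X `<=` @is_derivation R by move=> T [/smM|/sSM]; apply: Mder.
have [C [iota Ciota]] := constants_subfield Xder.
have [n [D [mD freeD smD]]] := relative_basis subS (subset_trans smM Mb).
exists C, iota, n, D; split=> //.
- move=> E mE; have [v Sv] := smD _ mE.
  have /choice [w Dw] : forall i, exists c, iota c = v 0 i.
    move=> i; apply/Ciota => T XT; have derT := Xder _ XT.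
    apply: (coefficients_constant subS freeD derT _ _ _ Sv).
    + by move=> U SU; case: XT => [/smL LT|ST]; [apply: LS | apply: SS].
    + move=> j; case: XT => [mT|ST]; first exact/m1S/derived_series_bracket.
      by apply: (bracket_mem_sym subS); apply: LS => //; apply/smL/mD.
    + case: XT => [mT|ST]; first exact/m1S/derived_series_bracket.
      by apply: (bracket_mem_sym subS); apply: LS => //; apply/smL.
  exists (\row_i w i); rewrite [combo _ _ _](_ : _ =
    combo rid D v) //.
  by apply: eq_bigr => i _; rewrite mxE Dw.
- by move=> T XT c; apply: (Ciota (iota c)).2 => //; exists c.
- move=> G c LG; have [GA _] := Lder LG.
  have ciota : constants X (iota c) by apply/Ciota; exists c.
  suff /Ciota [c' <-] : constants X (G (iota c)) by exists c'.
  move=> T XT; have XGT : X (bracket G T).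
    by case: XT => [mT|ST]; [left; apply: mJ | right; apply: LS].
  have := ciota _ XGT; rewrite /bracket (ciota _ XT) (additive_op0 GA) sub0r.
  by move/eqP; rewrite oppr_eq0 => /eqP.
Qed.

Let charC (C : fieldType) (iota : {rmorphism C -> R}) : [pchar C]%R =i pred0.
Proof. by move=> p; rewrite -(fmorph_pchar iota) charR. Qed.

Lemma derived_series_step i (S : set op) :
  stable_ideal S ->
  (forall D E, L_ i D -> L_ i E -> S (bracket D E)) -> L_ i.+1 `<=` S.
Proof.
move=> [[S0 SD SZ] _ _ _] iS; apply: derived_series_min => //.
by split=> // c D _; apply: SZ.
Qed.

Lemma centraliser_subspace (S I : set op) :
    Rsubspace S -> I `<=` M ->
  Psubspace P [set E : op | forall T, I T -> S (bracket E T)].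
Proof.
move=> [S0 SD SZ] sIM; have Sopp (E : op) : S E -> S (- E).
  by rewrite -scaleN1r; apply: SZ.
split=> [T IT|D E SDT SET T IT|c E Pc SET T IT];
  have derT := Mder (sIM _ IT); have [TA _] := derT.
- by rewrite bracket0l.
- rewrite bracketC bracketDr // (bracketC T D) (bracketC T E); apply: (Sopp).
  by apply: SD; apply: (Sopp); by [apply: SDT|apply: SET].
- rewrite bracketC bracketZr // (MP (sIM _ IT) Pc) scale0r add0r (bracketC T E).
  by apply/Sopp/SZ/Sopp/SET.
Qed.

(** L_(2d-2) lies in S' = R I and therefore kills C; one more step makes it
    centralise I modulo S, and another one brings it into S. *)
Theorem derived_series_rank d (b : 'I_d -> op) (S : set op) :
  stable_ideal S -> M `<=` Rspan b S -> L_ (2 * d) `<=` S.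
Proof.
elim: d b S => [|d IHd] b S idS Mb; have [subS sSM SS LS] := idS;
  have [S0 _ _] := subS.
  rewrite muln0; apply: subset_trans sLM _ => D /Mb [v].
  by rewrite /combo big_ord0 subr0.
case: (pselect (L `<=` S)) => [sLS|nLS].
  apply: subset_trans sLS; have [_ siL _] := Lser (2 * d.+1)%N; exact: siL.
have [m [nmS m1S]] := last_term_outside S0 nLS.
have [C [iota [n [D [mD smD killC Lcst]]]]] := layer_constants idS Mb m1S.
have [I [[sSI nIS sIM] IL II killI centI]] :=
  irreducible_layer subS sSM SS LS (charC iota) mD smD nmS m1S killC Lcst.
have [d' [b' [S' [[Dd] idS' Mb' killS' abS']]]] :=
  abelian_layer idS Mb sSI nIS sIM IL II.
subst d'; have sdS' := IHd b' S' idS' Mb'.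
have [_ sdL dJ] := Lser (2 * d)%N.
have cent E : L_ (2 * d).+1 E -> forall T, I T -> S (bracket E T).
  move: E; apply: derived_series_min; first exact: centraliser_subspace.
  move=> E E' dE dE' T IT.
  have kill_d F : L_ (2 * d) F -> forall c, F (iota c) = 0.
    by move=> /sdS' S'F c; apply: killS' S'F => U /killI.
  by apply: centI => //; by [exact: sdL|exact: kill_d].
have sdS1 : L_ (2 * d).+1 `<=` S'.
  apply: subset_trans sdS'.
  exact: (derived_series_decr P1 PM Lsub Lbr Lder LP (leqnSn _)).
rewrite mulnS; apply: derived_series_step => // E E' dE dE'.
by apply: abS'; by [exact: sdS1|exact: cent].
Qed.

(** As all of L kills C, the whole derived algebra of L centralises I modulo S,
    so that each layer costs one step only. *)
Theorem derived_series_fin_dim (C : fieldType) (iota : {rmorphism C -> R})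
    n (a : 'I_n -> op) d (b : 'I_d -> op) (S : set op) :
  (forall T c, M T -> T (iota c) = 0) -> L `<=` cspan iota a [set 0] ->
  stable_ideal S -> M `<=` Rspan b S -> L_ d.+1 `<=` S.
Proof.
move=> killM La; elim: d b S => [|d IHd] b S idS Mb;
  have [subS sSM SS LS] := idS; have [S0 _ _] := subS;
  have subSC := Rsubspace_restrict iota subS.
  have [_ siL _] := Lser 1%N; apply: subset_trans siL _.
  apply: subset_trans sLM _ => D /Mb [v].
  by rewrite /combo big_ord0 subr0.
case: (pselect (L `<=` S)) => [sLS|nLS].
  apply: subset_trans sLS; have [_ siL _] := Lser d.+2; exact: siL.
have [m [nmS m1S]] := last_term_outside S0 nLS.
have [_ smL _] := Lser m.
have smM : L_ m `<=` M := subset_trans smL sLM.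
have sma : L_ m `<=` cspan iota a S.
  by move=> D /smL /La [v Dv]; exists v; rewrite Dv.
have [n' [D [mD _ smD]]] := relative_basis subSC sma.
have [||I [[sSI nIS sIM] IL II killI centI]] :=
  irreducible_layer subS sSM SS LS (charC iota) mD smD nmS m1S.
- by move=> T [/smM MT|/sSM MT] c; apply: killM.
- by move=> G c LG; exists 0; rewrite rmorph0; apply/killM/sLM.
have [d' [b' [S' [[Dd] idS' Mb' _ abS']]]] :=
  abelian_layer idS Mb sSI nIS sIM IL II.
subst d'; have sdS' := IHd b' S' idS' Mb'.
have cent E : L_ d.+1 E -> forall T, I T -> S (bracket E T).
  have [_ sdL _] := Lser d.
  move: E; apply: derived_series_min; first exact: centraliser_subspace.
  move=> E E' /sdL LE /sdL LE' T IT.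
  by apply: centI => // c; apply/killM/sLM.
apply: derived_series_step => // E E' dE dE'.
by apply: abS'; by [exact: sdS'|exact: cent].
Qed.

End Layers.

(** * Derivations of the quotient field of a domain *)

Section GroundField.

Variables (K : fieldType) (A : idomainAlgType K).
Local Notation R := {fraction A}.
Local Notation op := (R -> R^o).

Lemma ground_field1 : ground_field A 1.
Proof. by exists 1 => //; rewrite /ground scale1r tofrac1. Qed.

Lemma ground_fieldM x y :
  ground_field A x -> ground_field A y -> ground_field A (x * y).
Proof.
move=> [c _ <-] [d _ <-]; exists (c * d) => //.
by rewrite /ground -tofracM mulr_algl scalerA.
Qed.

Lemma fraction_pchar : [pchar K]%R =i pred0 -> [pchar R]%R =i pred0.
Proof.
move=> /pcharf0P charK; apply/pcharf0P => n; rewrite -charK.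
rewrite -(rmorph_nat (@tofrac A)) tofrac_eq0 -(rmorph_nat (in_alg A)).
by rewrite fmorph_eq0.
Qed.

Lemma WA_derivation : WA A `<=`
  [set D : op | is_derivation D /\ forall c, ground_field A c -> D c = 0].
Proof.
apply: (@lspan_min _ setT).
  have [D0 DD DZ] := @derivation_subspace R; split.
  - by split.
  - move=> D E [derD kD] [derE kE]; split; first exact: DD.
    by move=> c Pc; rewrite !fctE kD // kE // addr0.
  - move=> f D _ [derD kD]; split; first exact: DZ.
    by move=> c Pc; rewrite !fctE kD // scaler0.
move=> D [[DD DZ DM] _]; have derD : is_derivation (D : op) by split.
split=> // _ [c _ <-].
by rewrite -[ground A c]mulr1 DZ (derivation1 derD) mulr0.
Qed.

End GroundField.

Theorem theorem2 (K : fieldType) (charK0 : [pchar K]%R =i pred0)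
    (A : idomainAlgType K) (L : set ({fraction A} -> {fraction A}))
    (subL : lie_subalgebra L) (solL : lie_solvable (ground_field A) L)
    (k : nat) (rkL : has_rank L k) :
  (derived_length solL <= 2 * k)%N /\
  (fin_dim_over_constants L -> (derived_length solL <= k + 1)%N).
Proof.
pose R : fieldType := {fraction A}; pose P : set R := ground_field A.
have [sLW L0 LD LZ Lbr] := subL; have [b _ Lb] := rkL.
have Lsub : @Psubspace R P L.
  by split=> // c D [a _ <-] LD'; exact: LZ.
(* R L, generated by the R-basis b that defines the rank of L. *)
pose M : set (R -> R^o) := Rspan b [set 0].
have sub0 := @zero_subspace R R (R -> R^o) idfun.
have subM : Rsubspace M := cspan_subspace sub0 b.
have [M0 MD MZ] := subM.
have sLTM : lspan setT L `<=` M.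
  rewrite -Lb; apply: lspan_min; first by split=> // c D _; apply: MZ.
  by move=> _ [i _ <-]; apply: cspan_gen.
have sLM : L `<=` M by move=> D LD'; apply: sLTM; apply: lspan_gen.
have Mmin (Y : set (R -> R^o)) :
    @Psubspace R setT Y -> L `<=` Y -> M `<=` Y.
  move=> subY sLY; have [Y0 YD YZ] := subY; apply: cspan_min.
  - by split=> // c D; apply: YZ.
  - by move=> _ ->.
  move=> i; apply: (lspan_min subY sLY); rewrite -Lb; apply: lspan_gen => //.
have killM c : (forall D, L D -> D c = 0) -> forall D, M D -> D c = 0.
  move=> Lc; apply: Mmin => //; split=> [//|D E Dc Ec|f D _ Dc].
    by rewrite /= !fctE Dc Ec addr0.
  by rewrite /= !fctE Dc scaler0.
have Lder D : L D -> is_derivation (D : R -> R^o) /\ forall c, P c -> D c = 0.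
  by move=> /sLW /WA_derivation.
have Mder : M `<=` @is_derivation R.
  apply: Mmin => [|D /Lder []//].
  have [D0 DD DZ] := @derivation_subspace R.
  by split=> // c D _; apply: DZ.
have MP (D : R -> R^o) c : M D -> P c -> D c = 0.
  by move=> MD' Pc; apply: killM MD' => E /Lder [_]; apply.
have charR := fraction_pchar A charK0.
have P1 := ground_field1 A; have PM := @ground_fieldM K A.
have [s Ls] := solL.
have Ls0 : (derived_series P L s : set (R -> R^o)) `<=` [set 0] by rewrite Ls.
have id0 : stable_ideal L M [set 0].
  split=> // [_ ->//|_ _ -> ->|G _ LG ->] /=.
    by rewrite bracket0r //; case: (@derivation_subspace R) => -[].
  by rewrite bracket0r //; case: (Lder _ LG) => -[].
have lengthP N : derived_series P L N `<=` [set (0 : R -> R^o)] ->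
    (derived_length solL <= N)%N.
  move=> LN0; rewrite /derived_length; case: ex_minnP => m _ minm.
  apply: minm; apply/asboolP/seteqP; split=> // _ ->.
  have LPder : L `<=` @is_derivation R by move=> D /Lder [].
  have LP (D : R -> R^o) c : L D -> P c -> D c = 0 by move=> /sLM; apply: MP.
  by have [[]] := derived_series_ideal P1 PM Lsub Lbr LPder LP N.
split.
  apply: lengthP.
  exact: (derived_series_rank P1 PM Lsub Lbr sLM Mder MP subM charR Ls0
    id0 (@subset_refl _ M)).
move=> [n [a _ La]]; apply: lengthP; rewrite addn1.
have LPder : L `<=` @is_derivation R by move=> D /Lder [].
have [C [iota Ciota]] := constants_subfield LPder.
have LC c : constants L (iota c) by apply/Ciota; exists c.
have kill_iota (T : R -> R^o) c : M T -> T (iota c) = 0.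
  by apply: killM => D; apply: LC.
pose a' : 'I_n -> R -> R^o := a.
suff La' : L `<=` cspan iota a' [set 0].
  exact: (derived_series_fin_dim P1 PM Lsub Lbr sLM Mder MP subM charR Ls0
    kill_iota La' id0 (@subset_refl _ M)).
have [Y0 YD YZ] := cspan_subspace (zero_subspace _ iota) a'.
apply: (@subset_trans _ (lspan (constants L) L)).
  by apply: lspan_gen => D LD'; apply: derivation1; case: (Lder _ LD').
rewrite -La; apply: lspan_min.
  by split=> // c D /Ciota [c' <-]; apply: YZ.
by move=> _ [i _ <-]; apply: cspan_gen; apply: zero_subspace.
Qed.
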